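(* Consider a finite irreducible Markov renewal process with state space $S=\{1,\dots,m\}$, embedded (jump) chain transition matrix $P$ with stationary probability vector $\pi$, mean sojourn time vector $\mu$, $\lambda=\pi^T\mu>0$, and mean first passage times $m_{ij}$. Let $k^{(3)}=(k^{(3)}_1,\dots,k^{(3)}_m)^T$ with $k_i^{(3)}=\sum_{j=1}^m m_{ij}/m_{jj}$. Then: (a) If $G$ is any g-inverse of $I-P$, then $$k^{(3)}=\tfrac1\lambda\{G\mu-\mathrm{tr}(G\mu\pi^T)e\}+e-Ge+\mathrm{tr}(G)e.$$ (b) If $Z=[I-P+\Pi]^{-1}$, then $$k^{(3)}=\tfrac1\lambda\{Z\mu-\mathrm{tr}(Z\mu\pi^T)e\}+\mathrm{tr}(Z)e.$$ (c) If $A^{\#}$ is the group inverse of $I-P$, then $$k^{(3)}=\tfrac1\lambda\{A^{\#}\mu-\mathrm{tr}(A^{\#}\mu\pi^T)e\}+e+\mathrm{tr}(A^{\#})e.$$ (d) If $\widetilde G=[I-P+\mu u^T]^{-1}$, where $u\in\mathbb{R}^m$ satisfies $u^Te\neq0$, then $$k^{(3)}=\left[I-\widetilde G+\mathrm{tr}(\widetilde G)I\right]e.$$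
   Context: A Markov renewal process (MRP) $\{(X_n,T_n),n\ge 0\}$ on $S=\{1,\dots,m\}$ has $T_0=0\le T_1\le T_2\le\cdots$ and semi-Markov kernel $Q_{ij}(t)=P\{X_{n+1}=j,\ T_{n+1}-T_n\le t\mid X_n=i\}$ (Markov property: conditionally on the past up to step $n$, the law of $(X_{n+1},T_{n+1}-T_n)$ depends only on $X_n$, through this kernel). The embedded Markov chain $\{X_n\}$ has transition matrix $P=[p_{ij}]$, $p_{ij}=Q_{ij}(+\infty)$; the MRP is called irreducible when $P$ is irreducible. Put $\mu_{ij}=\int_0^\infty t\,dQ_{ij}(t)$, assumed finite, and $\mu_i=\sum_k\mu_{ik}$, the mean sojourn time on a visit to state $i$; $\mu=(\mu_1,\dots,\mu_m)^T$. $\pi=(\pi_1,\dots,\pi_m)^T$ is the unique vector with $\pi^TP=\pi^T$, $\pi^Te=1$, where $e=(1,\dots,1)^T$; $\Pi=e\pi^T$. $\lambda=\pi^T\mu$, assumed positive. The mean first passage time is $m_{ij}=E[T_{ij}\mid X_0=i]$, where $T_{ij}=T_n$ with $n=\min\{r\ge1: X_r=j\}$ given $X_0=i$ (the return time if $i=j$); these are all finite. A g-inverse (one-condition generalized inverse) of $I-P$ is any matrix $G$ with $(I-P)G(I-P)=I-P$. The group inverse $A^{\#}$ of $A=I-P$ is the unique matrix with $AA^{\#}A=A$, $A^{\#}AA^{\#}=A^{\#}$, $AA^{\#}=A^{\#}A$; it equals $Z-\Pi$. *)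

(* Defs.v *)
From HB Require Import structures.
From mathcomp Require Import all_boot all_order all_algebra.
From mathcomp Require Import all_classical all_reals all_analysis.
Import Order.TTheory GRing.Theory Num.Theory.
Import numFieldNormedType.Exports.

Set Implicit Arguments.
Unset Strict Implicit.
Unset Printing Implicit Defensive.

Local Open Scope classical_set_scope.
Local Open Scope ring_scope.

(* A finite Markov renewal process is given by state variables X n, with values
   in the state space 'I_m, and renewal epochs T n. Its semi-Markov kernel is a
   matrix Q of nondecreasing right-continuous functions, so that the integrals
   against dQ_ij are integrals against Lebesgue-Stieltjes measures. *)

Section semi_markov_kernel.
Variables (R : realType) (m : nat) (Q : 'I_m -> 'I_m -> cumulative R R).

Definition jump_matrix : 'M[R]_m :=
  \matrix_(i, j) lim (Q i j t @[t --> +oo]).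

Definition kernel_mean (i j : 'I_m) : \bar R :=
  (\int[lebesgue_stieltjes_measure (Q i j)]_(t in `[0%R, +oo[) t%:E)%E.

Definition mean_sojourn : 'cV[R]_m := \col_i \sum_j fine (kernel_mean i j).

End semi_markov_kernel.

Definition irreducible_mx (R : realType) (m : nat) (P : 'M[R]_m) : Prop :=
  forall i j : 'I_m, exists n : nat, 0 < (P ^+ n) i j.

Section markov_renewal_process.
Context {d : measure_display} {Omega : measurableType d} {R : realType}.
Variables (m : nat) (X : nat -> Omega -> 'I_m) (T : nat -> {mfun Omega >-> R}).

(* The sigma-algebra generated by X_0, T_0, ..., X_n, T_n. *)
Definition past (n : nat) : set (set Omega) :=
  <<s [set A | exists2 k, (k <= n)%N &
         (exists i, A = [set w | X k w = i]) \/
         (exists t, A = [set w | T k w <= t])] >>.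

(* The last field is the Markov property: on {X_n = i}, the conditional
   probability of {X_{n+1} = j, T_{n+1} - T_n <= t} given the past up to step n
   is Q_ij(t). It is written as an integrated identity over the events A of the
   past, hence requires nothing at the states i that X_n does not charge. *)
Record is_markov_renewal_process (Pr : probability Omega R)
    (Q : 'I_m -> 'I_m -> cumulative R R) : Prop := {
  mrp_measurable_state : forall n i, measurable [set w | X n w = i] ;
  mrp_epoch0 : forall w, T 0%N w = 0 ;
  mrp_epoch_nondecreasing : forall n w, T n w <= T n.+1 w ;
  mrp_markov : forall n (i j : 'I_m) (t : R) (A : set Omega), past n A ->
    (Pr (A `&` [set w | X n w = i] `&`
         [set w | X n.+1 w = j /\ (T n.+1 w - T n w <= t)%R])
     = Pr (A `&` [set w | X n w = i]) * (Q i j t)%:E)%E }.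

(* T_n for n = min {r >= 1 | X_r = j}; it is +oo on the paths that never visit
   j after step 0. The initial state plays no role: for the start i = j this is
   the return time. *)
Definition first_passage_time (j : 'I_m) (w : Omega) : \bar R :=
  match pselect (exists r, (0 < r)%N && (X r w == j)) with
  | left visit => (T (ex_minn visit) w)%:E
  | right _ => +oo%E
  end.

(* E[Y | B] = E[Y 1_B] / Pr(B), meaningful when Pr(B) > 0. *)
Definition cond_expectation_event (Pr : probability Omega R) (Y : Omega -> \bar R)
    (B : set Omega) : \bar R :=
  ((\int[Pr]_(w in B) Y w) * (fine (Pr B))^-1%:E)%E.

(* m_ij = E[T_ij | X_0 = i]. The process comes with one law Pr i for each
   starting state i: Pr i may be the law of the process started at i, or all the
   Pr i may be one law whose initial distribution charges every state. *)
Definition mean_first_passage (Pr : 'I_m -> probability Omega R) : 'M[R]_m :=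
  \matrix_(i, j) fine (cond_expectation_event (Pr i) (first_passage_time j)
                         [set w | X 0%N w = i]).

End markov_renewal_process.

Section generalized_inverses.
Variables (R : realType) (m : nat).
Implicit Types A G : 'M[R]_m.

Definition is_ginverse A G : Prop := A *m G *m A = A.

Definition is_group_inverse A G : Prop :=
  [/\ A *m G *m A = A, G *m A *m G = G & A *m G = G *m A].

End generalized_inverses.

Definition k3 (R : realType) (m : nat) (M : 'M[R]_m) : 'cV[R]_m :=
  \col_i \sum_j M i j / M j j.

(* Main.v *)
(* Idea. Let P_j be P with its j-th column replaced by 0. The entry (i, l) of
   P_j^n is the probability, starting from i, of avoiding j at the steps 1..n and
   being at l at step n, so integrating the sojourns before the first visit to j
   gives m_ij = sum_n (P_j^n mu)_i, which is ((I - P_j)^-1 mu)_i by irreducibility.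
   Hence M = mu e^T + P (M - M_d) with M_d the diagonal part of M, and multiplying
   by pi^T gives m_jj = lambda / pi_j. The matrix N = M M_d^-1 therefore satisfies
   (I - P) N = mu pi^T / lambda - P, which together with N_jj = 1 determines N from
   any g-inverse G, because I - G (I - P) = e c^T with c^T e = 1. This yields (a)
   for k = N e, and the matrices in (b), (c), (d) are particular g-inverses. *)

Require Import Defs.
From HB Require Import structures.
From mathcomp Require Import all_boot all_order all_algebra.
From mathcomp Require Import all_classical all_reals all_analysis.
From mathcomp Require Import measurable_realfun ring.
Import Order.TTheory GRing.Theory Num.Theory.
Import numFieldNormedType.Exports.

Set Implicit Arguments.
Unset Strict Implicit.
Unset Printing Implicit Defensive.

Local Open Scope classical_set_scope.
Local Open Scope ring_scope.

(** * Stochastic matrices *)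

Lemma unitmx_ker0 (F : fieldType) (m : nat) (B : 'M[F]_m) :
  (forall v : 'cV[F]_m, B *m v = 0 -> v = 0) -> B \in unitmx.
Proof.
move=> Bker; rewrite -unitmx_tr -row_free_unit -kermx_eq0; apply/rowV0P => v.
move=> /sub_kermxP vB; apply: trmx_inj.
by rewrite trmx0; apply: Bker; rewrite -[B]trmxK -trmx_mul vB trmx0.
Qed.

(** Only entering [j] is forbidden, not leaving it: row [j] is kept apart from its [j]-th entry, so
    the same matrix serves the return time from [j]. *)
Definition taboo_mx (R : realType) (m : nat) (P : 'M[R]_m) (j : 'I_m) : 'M[R]_m :=
  \matrix_(k, l) (P k l *+ (l != j)).

Section stochastic_matrix.
Variables (R : realType) (m : nat) (P : 'M[R]_m).
Local Notation e := (const_mx 1 : 'cV[R]_m).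
Local Notation taboo := (taboo_mx P).
Hypothesis P_ge0 : forall i j, 0 <= P i j.
Hypothesis Pe : P *m e = e.
Hypothesis Pirr : irreducible_mx P.

(** Minimum principle. Iteration gives P^n w <= w; at [i0] this reads sum_k (P^n)_{i0 k} w_k <= 0
    with nonnegative terms, and irreducibility supplies, for each k, an n with a positive
    coefficient. *)
Lemma superharmonic_eq0 (w : 'cV[R]_m) (i0 : 'I_m) :
  (forall i, 0 <= w i 0) -> (forall i, (P *m w) i 0 <= w i 0) ->
  w i0 0 = 0 -> w = 0.
Proof.
move=> w0 Pw wi0.
have Pn_ge0 n i j : 0 <= (P ^+ n) i j.
  elim: n i j => [|n IHn] i j; first by rewrite expr0 mxE ler0n.
  by rewrite exprS mxE; apply: sumr_ge0 => k _; rewrite mulr_ge0.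
have Pnw n i : (P ^+ n *m w) i 0 <= w i 0.
  elim: n i => [|n IHn] i; first by rewrite expr0 mul1mx.
  apply: le_trans (Pw i).
  rewrite exprS -mulmxA !mxE; apply: ler_sum => k _.
  by rewrite ler_wpM2l.
apply/matrixP => k l; rewrite ord1 [RHS]mxE.
have [n Pn] := Pirr i0 k.
apply/eqP; rewrite eq_le w0 andbT -(pmulr_rle0 _ Pn).
have := Pnw n i0; rewrite wi0; apply: le_trans; rewrite mxE (bigD1 k) //= lerDl.
by apply: sumr_ge0 => k' _; rewrite mulr_ge0.
Qed.

Lemma mul_taboo_mx (v : 'cV[R]_m) (j : 'I_m) :
  taboo j *m v = P *m v - v j 0 *: col j P.
Proof.
apply/matrixP => i l; rewrite ord1 !mxE (bigD1 j) //= [in RHS](bigD1 j) //=.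
rewrite !mxE eqxx mulr0n mul0r add0r [v j 0 * _]mulrC addrAC subrr add0r.
by apply: eq_bigr => k kj; rewrite mxE kj mulr1n.
Qed.

Lemma max_entry (v : 'cV[R]_m) (i0 : 'I_m) : exists i, forall k, v k 0 <= v i 0.
Proof.
case: (arg_maxP (fun k => v k 0) (isT : xpredT i0)) => i _ vi.
by exists i => k; exact: vi.
Qed.

(** Maximum principle: if [v] is maximal at i, then v_i e - v is nonnegative, superharmonic because
    P e = e, and zero at i. *)
Lemma subharmonic_const (v : 'cV[R]_m) (i0 : 'I_m) :
  (forall i, v i 0 <= (P *m v) i 0) -> v = v i0 0 *: e.
Proof.
move=> vP; have [i vi] := max_entry v i0.
have vE : v = v i 0 *: e.
  suff: v i 0 *: e - v = 0 by move/eqP; rewrite subr_eq0 => /eqP.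
  apply: (@superharmonic_eq0 _ i) => [k|k|]; last by rewrite !mxE mulr1 subrr.
  - by rewrite !mxE mulr1 subr_ge0.
  - rewrite mulmxBr -scalemxAr Pe [leLHS]mxE [leRHS]mxE lerD2l.
    by rewrite [leLHS]mxE [leRHS]mxE lerN2.
by rewrite [in RHS]vE 2!mxE mulr1.
Qed.

Lemma ker_sub1P (v : 'cV[R]_m) (i0 : 'I_m) :
  (1%:M - P) *m v = 0 -> v = v i0 0 *: e.
Proof.
rewrite mulmxBl mul1mx => /eqP; rewrite subr_eq0 => /eqP vP.
by apply: subharmonic_const => i; rewrite -vP.
Qed.

(** If column [j] vanished, [j] could only be reached in 0 steps, so by irreducibility it would be
    the only state; its row sum would then be 0 instead of 1. *)
Lemma col_stochastic_neq0 (j : 'I_m) : exists i, P i j != 0.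
Proof.
apply: contrapT => /forallNP Pj0.
have {}Pj0 i : P i j = 0 by apply/eqP/negP => /negP; exact: Pj0.
have allj i : i = j.
  have [[|n]] := Pirr i j.
    by rewrite expr0 mxE; case: eqVneq => //; rewrite ltxx.
  by rewrite exprSr mxE big1 ?ltxx // => k _; rewrite Pj0 mulr0.
have /matrixP/(_ j 0) := Pe; rewrite !mxE big1 => [/esym/eqP|k _].
  by rewrite oner_eq0.
by rewrite (allj k) Pj0 mul0r.
Qed.

(** Up to sign v_j >= 0, and then P v = v + v_j (column j of P) >= v. So [v] is constant, P v = v,
    and v_j times a nonzero column is 0. *)
Lemma taboo_fixed_eq0 (j : 'I_m) (v : 'cV[R]_m) : taboo j *m v = v -> v = 0.
Proof.
wlog vj0 : v / 0 <= v j 0 => [wlg|] vE.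
  have [/wlg|vj] := leP 0 (v j 0); first exact.
  apply/eqP; rewrite -oppr_eq0; apply/eqP; apply: wlg; last by rewrite mulmxN vE.
  by rewrite mxE oppr_ge0 ltW.
have PvE : P *m v = v + v j 0 *: col j P.
  by apply/eqP; rewrite -subr_eq -mul_taboo_mx vE.
have vc : v = v j 0 *: e.
  by apply: subharmonic_const => i; rewrite PvE !mxE lerDl mulr_ge0.
have [i Pij] := col_stochastic_neq0 j.
have /eqP : v j 0 *: col j P = 0.
  apply: (addrI v); rewrite -PvE addr0 [in LHS]vc -scalemxAr Pe.
  by rewrite -vc.
rewrite scaler_eq0 => /orP[/eqP vj|/eqP/matrixP/(_ i 0)].
  by rewrite vc vj scale0r.
by rewrite !mxE => /eqP; rewrite (negPf Pij).
Qed.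

Lemma unitmx_sub1_taboo (j : 'I_m) : 1%:M - taboo j \in unitmx.
Proof.
apply: unitmx_ker0 => v; rewrite mulmxBl mul1mx => /eqP.
by rewrite subr_eq0 => /eqP/esym/taboo_fixed_eq0.
Qed.

Lemma taboo_exp_ge0 (j : 'I_m) n i k : 0 <= (taboo j ^+ n) i k.
Proof.
elim: n i k => [|n IHn] i k; first by rewrite expr0 mxE ler0n.
rewrite exprS mxE; apply: sumr_ge0 => l _; rewrite mulr_ge0 //.
by rewrite mxE mulrn_wge0.
Qed.

Lemma mulmx_ge0 (A : 'M[R]_m) (v : 'cV[R]_m) :
  (forall i k, 0 <= A i k) -> (forall k, 0 <= v k 0) -> forall i, 0 <= (A *m v) i 0.
Proof. by move=> A0 v0 i; rewrite mxE; apply: sumr_ge0 => k _; rewrite mulr_ge0. Qed.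

Lemma cvg_mulmx (A : 'M[R]_m) (s : nat -> 'cV[R]_m) (l : 'cV[R]_m) :
  (forall i, s n i 0 @[n --> \oo] --> l i 0) ->
  forall i, (A *m s n) i 0 @[n --> \oo] --> (A *m l) i 0.
Proof.
move=> sl i; rewrite [X in _ --> X]mxE.
under eq_fun do rewrite mxE.
apply: cvg_big => [|k _]; first exact: add_continuous.
apply: cvgM; [exact: cvg_cst|exact: sl].
Qed.

(* The sequence decreases, and its limit is a fixed vector of the taboo matrix. *)
Lemma cvg_taboo_exp (j : 'I_m) (i : 'I_m) :
  (taboo j ^+ n *m e) i 0 @[n --> \oo] --> 0.
Proof.
pose s n := taboo j ^+ n *m e.
have sS n : s n.+1 = taboo j *m s n by rewrite /s exprS -mulmxA.
have s_ge0 n i' : 0 <= s n i' 0.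
  by apply: mulmx_ge0 => [? ?|?]; [exact: taboo_exp_ge0|rewrite mxE].
have s_cvg i' : cvgn (fun n => s n i' 0).
  apply: nonincreasing_is_cvgn; last by exists 0 => _ [n _ <-].
  apply/nonincreasing_seqP => n; rewrite /s exprSr -mulmxA -subr_ge0.
  have -> : (taboo j ^+ n *m e) i' 0 - (taboo j ^+ n *m (taboo j *m e)) i' 0
      = (taboo j ^+ n *m (e - taboo j *m e)) i' 0.
    by rewrite mulmxBr [RHS]mxE [X in _ = _ + X]mxE.
  apply: mulmx_ge0 => [? ?|k]; first exact: taboo_exp_ge0.
  (* The vector e - P_j e is the [j]-th column of P, hence nonnegative. *)
  by rewrite mul_taboo_mx Pe opprB addrC subrK !mxE mul1r.
pose l : 'cV[R]_m := \col_i limn (fun n => s n i 0).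
have sl i' : s n i' 0 @[n --> \oo] --> l i' 0 by rewrite mxE; exact: s_cvg.
suff l0 : l = 0 by have := sl i; rewrite l0 mxE.
apply: (@taboo_fixed_eq0 j); apply/matrixP => i' z; rewrite ord1.
apply: (@cvg_unique _ (@Rhausdorff R) (s n.+1 i' 0 @[n --> \oo])).
  by have := cvg_mulmx (A := taboo j) sl (i := i'); under eq_fun do rewrite -sS.
by have := sl i'; rewrite -(cvg_shiftS (fun n => s n i' 0)).
Qed.

Lemma sum_taboo_exp (j : 'I_m) (v : 'cV[R]_m) (N : nat) :
  \sum_(0 <= n < N) taboo j ^+ n *m v =
  invmx (1%:M - taboo j) *m (v - taboo j ^+ N *m v).
Proof.
rewrite -[LHS](mulKmx (unitmx_sub1_taboo j)); congr (_ *m _).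
elim: N => [|N IHN]; first by rewrite big_geq // mulmx0 expr0 mul1mx subrr.
by rewrite big_nat_recr //= mulmxDr IHN mulmxBl mul1mx addrA subrK exprS mulmxA.
Qed.

(** Neumann series: the partial sums are (I - P_j)^-1 (v - P_j^N v), and the remainder P_j^N v is
    squeezed between 0 and c P_j^N e, where c, the sum of the entries of [v], dominates each of
    them. *)
Lemma cvg_sum_taboo_exp (j : 'I_m) (v : 'cV[R]_m) (i : 'I_m) :
  (forall k, 0 <= v k 0) ->
  \sum_(0 <= n < N) (taboo j ^+ n *m v) i 0 @[N --> \oo] -->
  (invmx (1%:M - taboo j) *m v) i 0.
Proof.
move=> v0; pose c := \sum_k v k 0.
have tv k : (taboo j ^+ n *m v) k 0 @[n --> \oo] --> 0.
  apply: (@squeeze_cvgr _ _ _ _ (fun=> 0) (fun n => c * (taboo j ^+ n *m e) k 0)).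
  - apply: nearW => n; apply/andP; split.
      by apply: mulmx_ge0 => // ? ?; exact: taboo_exp_ge0.
    rewrite !mxE mulr_sumr; apply: ler_sum => l _.
    rewrite mxE mulr1 mulrC; apply: ler_wpM2r; first exact: taboo_exp_ge0.
    by rewrite /c (bigD1 l) //= lerDl sumr_ge0.
  - exact: cvg_cst.
  - rewrite -[X in _ --> X](mulr0 c).
    by apply: cvgM; [exact: cvg_cst|exact: cvg_taboo_exp].
under eq_fun => N.
  rewrite (_ : \sum_(0 <= n < N) _ =
    (invmx (1%:M - taboo j) *m (v - taboo j ^+ N *m v)) i 0); last first.
    by rewrite -sum_taboo_exp summxE.
  over.
apply: cvg_mulmx => k; rewrite -[X in _ --> X]subr0.
under eq_fun do rewrite mxE [X in _ + X]mxE.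
by apply: cvgB; [exact: cvg_cst|exact: tv].
Qed.

End stochastic_matrix.

(** * The linear system of mean first passage times *)

Lemma col_mul (R : pzSemiRingType) (m n p : nat) (A : 'M[R]_(m, n))
    (B : 'M[R]_(n, p)) (j : 'I_p) :
  col j (A *m B) = A *m col j B.
Proof. by apply/matrixP => i l; rewrite !mxE; apply: eq_bigr => h _; rewrite mxE. Qed.

Section first_passage_system.
Variables (R : realType) (m : nat) (P : 'M[R]_m) (mu pi : 'cV[R]_m) (M : 'M[R]_m).
Local Notation e := (const_mx 1 : 'cV[R]_m).
Local Notation lambda := ((pi^T *m mu) 0 0).
Local Notation k := (k3 M).
Hypothesis Pe : P *m e = e.
Hypothesis ker1P : forall (v : 'cV[R]_m) i, (1%:M - P) *m v = 0 -> v = v i 0 *: e.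
Hypothesis piP : pi^T *m P = pi^T.
Hypothesis pi1 : pi^T *m e = 1%:M.
Hypothesis lambda_gt0 : 0 < lambda.
Hypothesis M_taboo : forall j, col j M = mu + taboo_mx P j *m col j M.

Let N : 'M[R]_m := \matrix_(i, j) (M i j / M j j).

Lemma sub1P_col_passage (j : 'I_m) :
  (1%:M - P) *m col j M = mu - M j j *: col j P.
Proof.
rewrite mulmxBl mul1mx {1}M_taboo mul_taboo_mx !mxE.
by rewrite addrA addrAC addrK.
Qed.

(** Obtained by applying pi^T, which annihilates I - P. In product form, positivity of lambda shows
    at once that both factors are nonzero. *)
Lemma passage_diag (j : 'I_m) : M j j * pi j 0 = lambda.
Proof.
have /matrixP/(_ 0 0) : pi^T *m ((1%:M - P) *m col j M) = 0.
  by rewrite mulmxA mulmxBr mulmx1 piP subrr mul0mx.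
rewrite sub1P_col_passage mulmxBr -scalemxAr -col_mul piP.
by rewrite !mxE => /eqP; rewrite subr_eq0 => /eqP ->.
Qed.

Lemma passage_diag_neq0 (j : 'I_m) : M j j != 0.
Proof.
by apply/eqP => Mj; have := lambda_gt0; rewrite -(passage_diag j) Mj mul0r ltxx.
Qed.

Lemma sub1P_normalized_passage :
  (1%:M - P) *m N = lambda^-1 *: (mu *m pi^T) - P.
Proof.
have colN j : col j N = (M j j)^-1 *: col j M.
  by apply/matrixP => i l; rewrite !mxE mulrC.
apply/matrixP => i j; have := passage_diag_neq0 j => Mj.
transitivity ((col j ((1%:M - P) *m N)) i 0); first by rewrite [RHS]mxE.
rewrite col_mul colN -scalemxAr sub1P_col_passage scalerBr scalerA mulVf // scale1r.
rewrite -(passage_diag j) !mxE big_ord1 !mxE.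
have pij : pi j 0 != 0.
  by apply/eqP => pj; have := lambda_gt0; rewrite -(passage_diag j) pj mulr0 ltxx.
by field; rewrite pij Mj.
Qed.

Lemma k3_ginverse (G : 'M[R]_m) : is_ginverse (1%:M - P) G ->
  k = lambda^-1 *: (G *m mu - \tr (G *m mu *m pi^T) *: e)
      + e - G *m e + \tr G *: e.
Proof.
move=> GE; have [W WD] : exists W, W = 1%:M - G *m (1%:M - P) by eexists.
(* With m = 0 the sum pi^T e would be empty, hence 0. *)
have [i0 _] : exists i : 'I_m, True.
  case: (posnP m) => [m0|m0]; last by exists (Ordinal m0).
  move/matrixP/(_ 0 0)/eqP: pi1; rewrite !mxE big1 ?(eq_sym 0) ?oner_eq0 // => i.
  by have := ltn_ord i; rewrite {2}m0.
(* The columns of [W] lie in the kernel of I - P, which is spanned by e. So all rows of [W] agree,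
   and row [i0] can play the part of c^T. *)
have WE : W = e *m row i0 W.
  have AW : (1%:M - P) *m W = 0.
    by rewrite WD mulmxBr mulmx1 mulmxA GE subrr.
  apply/matrixP => i j; rewrite mxE big_ord1 !mxE mul1r.
  have : col j W = (col j W) i0 0 *: e.
    by apply: ker1P; rewrite -col_mul AW col0.
  by move/matrixP/(_ i 0); rewrite !mxE mulr1.
have ce : row i0 W *m e = 1%:M.
  have : W *m e = e.
    by rewrite WD mulmxBl mul1mx -mulmxA mulmxBl mul1mx Pe subrr mulmx0 subr0.
  rewrite -row_mul => ->; apply/matrixP => a b.
  by rewrite !ord1 !mxE.
have trW : \tr W = 1 by rewrite WE mxtrace_mulC ce mxtrace1.
have trGP : \tr (G *m P) = 1 - m%:R + \tr G.
  move: trW; rewrite WD raddfB /= mulmxBr mulmx1 raddfB /= mxtrace1 => trW1.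
  by rewrite -[X in X - _]trW1; ring.
(* The row b = c^T N is the only part of [N] that the equation for (I - P) N leaves undetermined. *)
pose b := row i0 W *m N.
have NE : N = lambda^-1 *: (G *m mu *m pi^T) - G *m P + e *m b.
  have : N = G *m ((1%:M - P) *m N) + W *m N.
    by rewrite WD mulmxA -mulmxDl addrC subrK mul1mx.
  move=> {1}->; rewrite sub1P_normalized_passage mulmxBr -scalemxAr mulmxA.
  by rewrite {1}WE -[_ *m row i0 W *m N]mulmxA.
have trN : \tr N = m%:R.
  rewrite /mxtrace; under eq_bigr do rewrite mxE divff ?passage_diag_neq0 //.
  by rewrite sumr_const card_ord.
(* Since k = N e, only the scalar b e is needed. It equals tr(e b), so the single equation tr N = m,
   which sums up N_jj = 1, is enough. *)
have be : (b *m e) 0 0 = 1 + \tr G - lambda^-1 * \tr (G *m mu *m pi^T).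
  move: trN; rewrite {1}NE raddfD raddfB /= linearZ /= trGP.
  rewrite [\tr (e *m b)]mxtrace_mulC [\tr (b *m e)]trace_mx11.
  by move/(canRL (addKr _)) => ->; ring.
have -> : k = N *m e.
  by apply/matrixP => i j; rewrite !mxE; apply: eq_bigr => l _; rewrite !mxE mulr1.
rewrite {1}NE mulmxDl mulmxBl -scalemxAl -[_ *m pi^T *m e]mulmxA pi1 mulmx1.
rewrite -[G *m P *m e]mulmxA Pe -[e *m b *m e]mulmxA.
have -> : e *m (b *m e) = (b *m e) 0 0 *: e.
  by rewrite [b *m e in LHS]mx11_scalar -scalemx1 -scalemxAr mulmx1.
rewrite be; apply/matrixP => i j; rewrite !mxE; ring.
Qed.

(** For x in the kernel, applying pi^T leaves (pi^T v)(w^T x) = 0, so w^T x = 0 and (I - P) x = 0.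
    Thus x is a multiple of e, and w^T e != 0 forces x = 0. This covers the matrices inverted in (b)
    and (d). *)
Lemma unitmx_sub1P_add (v w : 'cV[R]_m) :
  (pi^T *m v) 0 0 != 0 -> (w^T *m e) 0 0 != 0 ->
  1%:M - P + v *m w^T \in unitmx.
Proof.
move=> piv we; apply: unitmx_ker0 => x Bx0.
have wx0 : w^T *m x = 0.
  have : pi^T *m ((1%:M - P + v *m w^T) *m x) = 0 by rewrite Bx0 mulmx0.
  rewrite mulmxA mulmxDr mulmxBr mulmx1 piP subrr add0r !mulmxA -mulmxA.
  rewrite [pi^T *m v]mx11_scalar mul_scalar_mx => /eqP.
  by rewrite scaler_eq0 (negPf piv) => /eqP.
move: Bx0; rewrite mulmxDl -mulmxA wx0 mulmx0 addr0 => Ax0.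
(* Without states, every vector is empty. *)
have [[i0 _]|noI] := pselect (exists i : 'I_m, True); last first.
  by apply/matrixP => i; case: noI; exists i.
move: wx0; rewrite (ker1P i0 Ax0) -scalemxAr => /matrixP/(_ 0 0)/eqP.
rewrite mxE [X in _ == X]mxE mulf_eq0 (negPf we) orbF => /eqP ->.
by rewrite scale0r.
Qed.

(** Z e = e makes the terms e - Z e cancel. From pi^T Z = pi^T follows (I - P) Z = I - e pi^T, and
    pi^T (I - P) = 0 then makes [Z] a g-inverse. *)
Lemma k3_fundamental (Z : 'M[R]_m) : Z = invmx (1%:M - P + e *m pi^T) ->
  k = lambda^-1 *: (Z *m mu - \tr (Z *m mu *m pi^T) *: e) + \tr Z *: e.
Proof.
move=> ZE; have Bu : 1%:M - P + e *m pi^T \in unitmx.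
  by apply: unitmx_sub1P_add; rewrite pi1 mxE oner_eq0.
have Ze : Z *m e = e.
  rewrite -[RHS](mulKmx Bu) -ZE mulmxDl mulmxBl mul1mx Pe subrr add0r.
  by rewrite -mulmxA pi1 mulmx1.
have piZ : pi^T *m Z = pi^T.
  rewrite ZE -[RHS](mulmxK Bu) mulmxDr mulmxBr mulmx1 piP subrr add0r.
  by rewrite mulmxA pi1 mul1mx.
rewrite (@k3_ginverse Z) ?Ze ?addrK //.
rewrite /is_ginverse -[X in X *m Z](addrK (e *m pi^T)) mulmxBl {1}ZE mulmxV //.
rewrite -mulmxA piZ mulmxBl mul1mx -mulmxA mulmxBr mulmx1 piP subrr mulmx0.
by rewrite subr0.
Qed.

(** Commutation gives A = A (I - P) A = A A (I - P), hence A e = 0. *)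
Lemma k3_group_inverse (A : 'M[R]_m) : is_group_inverse (1%:M - P) A ->
  k = lambda^-1 *: (A *m mu - \tr (A *m mu *m pi^T) *: e) + e + \tr A *: e.
Proof.
case=> AGA GAG AG; rewrite (@k3_ginverse A) //.
suff -> : A *m e = 0 by rewrite subr0.
by rewrite -GAG -[A *m _ *m A]mulmxA AG -!mulmxA mulmxBl mul1mx Pe subrr !mulmx0.
Qed.

(** G mu = e / (u^T e), so the bracket G mu - tr(G mu pi^T) e vanishes. From u^T G = pi^T / lambda
    follows (I - P) G = I - mu pi^T / lambda, which makes [G] a g-inverse. *)
Lemma k3_rank_one (u : 'cV[R]_m) (G : 'M[R]_m) : (u^T *m e) 0 0 != 0 ->
  G = invmx (1%:M - P + mu *m u^T) -> k = (1%:M - G + (\tr G)%:M) *m e.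
Proof.
move=> ue GE; have Bu : 1%:M - P + mu *m u^T \in unitmx.
  by apply: unitmx_sub1P_add => //; rewrite gt_eqF.
have Gmu : G *m mu = ((u^T *m e) 0 0)^-1 *: e.
  rewrite -[RHS](mulKmx Bu) -GE; congr (_ *m _); rewrite -scalemxAr mulmxDl.
  rewrite mulmxBl mul1mx Pe subrr add0r -mulmxA [u^T *m e]mx11_scalar.
  by rewrite mul_mx_scalar mxE mulr1n scalerA mulVf // scale1r.
have uG : u^T *m G = lambda^-1 *: pi^T.
  rewrite GE -[RHS](mulmxK Bu); congr (_ *m _); rewrite -scalemxAl mulmxDr.
  rewrite mulmxBr mulmx1 piP subrr add0r mulmxA [pi^T *m mu]mx11_scalar.
  by rewrite mul_scalar_mx mxE mulr1n scalerA mulVf ?scale1r // gt_eqF.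
rewrite (@k3_ginverse G); last first.
  rewrite /is_ginverse -[X in X *m G](addrK (mu *m u^T)) mulmxBl {1}GE mulmxV //.
  rewrite -mulmxA uG mulmxBl mul1mx -mulmxA -scalemxAl mulmxBr mulmx1 piP subrr.
  by rewrite scaler0 mulmx0 subr0.
rewrite Gmu -scalemxAl mxtraceZ mxtrace_mulC pi1 mxtrace1 mulr1 subrr scaler0 add0r.
by rewrite mulmxDl mulmxBl mul1mx mul_scalar_mx.
Qed.

End first_passage_system.

(** * Sojourn times and first passages *)

Section measure_lemmas.
Context {d : measure_display} {Omega : measurableType d} {R : realType}.
Local Open Scope ereal_scope.

(** The restricted measure agrees with [mu] on the subsets of [E] and is zero on the subsets of its
    complement, so [D] is split along [E]. *)
Lemma ge0_integral_mrestr (mu : {measure set Omega -> \bar R}) (E : set Omega)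
    (mE : measurable E) (f : Omega -> \bar R) (D : set Omega) :
  measurable D -> measurable_fun D f -> (forall w, D w -> 0 <= f w) ->
  \int[mrestr mu mE]_(w in D) f w = \int[mu]_(w in D `&` E) f w.
Proof.
move=> mD mf f0.
have mDE : measurable (D `&` E) by exact: measurableI.
have mDnE : measurable (D `\` E) by exact: measurableD.
have DE : D `&` E `|` D `\` E = D by rewrite setUIDK.
rewrite -{1}DE ge0_integral_setU ?DE //; last first.
  by apply/disj_setPS => w [[_ Ew] [_]].
rewrite [X in X + _](eq_measure_integral mu) => [|A mA AD]; last first.
  by rewrite /= /mrestr setIidl // => w /AD[].
rewrite [X in _ + X](eq_measure_integral mzero) => [|A mA AD]; last first.
  by rewrite /= /mrestr (_ : A `&` E = set0) ?measure0 // -subset0 => w [/AD[]].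
by rewrite integral_measure_zero adde0.
Qed.

Lemma lebesgue_stieltjes_itvoc (F : cumulative R R) (a b : R) : (a <= b)%R ->
  lebesgue_stieltjes_measure F `]a, b] = (F b - F a)%:E.
Proof.
move=> ab; rewrite /lebesgue_stieltjes_measure /measure_extension measurable_mu_extE /=.
  by rewrite wlength_itv_bnd.
exact: is_ocitv.
Qed.

(** Change of variables: [mu] restricted to [E], pushed forward by [D] and divided by [c], agrees
    with dF on the intervals ]a, b], hence everywhere. As [D] is nonnegative, integrating over [0,
    +oo[ loses nothing. *)
Lemma integral_cumulative_law (mu : {measure set Omega -> \bar R})
    (E : set Omega) (D : {mfun Omega >-> R}) (F : cumulative R R) (c : R) :
  measurable E -> (forall w, (0 <= D w)%R) ->
  (0 <= c)%R -> mu E <= c%:E ->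
  (forall t, mu (E `&` [set w | (D w <= t)%R]) = (c * F t)%:E) ->
  \int[mu]_(w in E) (D w)%:E =
  c%:E * \int[lebesgue_stieltjes_measure F]_(t in `[0%R, +oo[) t%:E.
Proof.
move=> mE D0 c0 muE muF.
have mEt t : measurable (E `&` [set w | (D w <= t)%R]).
  apply: measurableI => //.
  rewrite (_ : [set _ | _] = D @^-1` `]-oo, t]); first exact: measurable_funPTI.
  by apply/seteqP; split => w /=; rewrite in_itv.
have mDE : measurable_fun E (fun w => (D w)%:E).
  by apply/measurable_EFinP; apply: measurable_funTS.
move: c0; rewrite le_eqVlt => /orP[/eqP c0|c_gt0].
  (* For c = 0 no rescaling is possible, but the bound on [mu E] makes [E] a null set. *)
  rewrite -c0 mul0e; apply: null_set_integral => //.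
  by apply/eqP; rewrite eq_le measure_ge0 andbT; rewrite -c0 in muE.
have ci_ge0 : (0 <= c^-1)%R by rewrite invr_ge0 ltW.
(* The displays of [R] and [measurableTypeR R] differ, their sigma-algebras do not. *)
pose D' : Omega -> measurableTypeR R := D.
have mD : measurable_fun setT D'.
  by move=> _ A mA; rewrite setTI; exact: (measurable_funPTI D).
have [rho rhoE] : exists rho : {measure set (measurableTypeR R) -> \bar R},
    rho = pushforward (mrestr mu mE) D' :> (set R -> \bar R).
  by exists (measure_function_pushforward__canonical__measure_function_Measure
    (mrestr mu mE) mD).
have rhoI : \int[rho]_(t in `[0%R, +oo[) t%:E = \int[mu]_(w in E) (D w)%:E.
  have mEFin : measurable_fun (`[0%R, +oo[ : set (measurableTypeR R)) (@EFin R).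
    exact: EFin_measurable.
  have push := @ge0_integral_pushforward _ _ _ _ _ _ mD (mrestr mu mE)
    `[0%R, +oo[ EFin (measurable_itv _) mEFin.
  transitivity (\int[mrestr mu mE]_(w in D' @^-1` `[0%R, +oo[) (D w)%:E).
    rewrite -push; last first.
      by move=> t; rewrite inE /= in_itv /= andbT lee_fin.
    by apply: eq_measure_integral => A mA _; rewrite rhoE.
  rewrite (_ : D' @^-1` _ = setT); last first.
    by apply/seteqP; split => w // _; rewrite /= in_itv /= D0.
  rewrite ge0_integral_mrestr ?setTI //; last by move=> w _; rewrite lee_fin.
  exact/measurable_EFinP.
pose nu := mscale (NngNum ci_ge0) rho.
have nuF A : measurable A -> lebesgue_stieltjes_measure F A = nu A.
  apply: lebesgue_stieltjes_measure_unique => _ [[a b] _ <-] /=.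
  have [ab|ba] := leP a b; last first.
    by rewrite set_itv_ge ?bnd_simp -?leNgt ?ltW // !measure0.
  rewrite lebesgue_stieltjes_itvoc // /nu /mscale /= rhoE.
  rewrite /pushforward /mrestr.
  (* A difference of two sublevel events, whose masses are given by [muF]. *)
  have -> : D' @^-1` `]a, b] `&` E =
      (E `&` [set w | (D w <= b)%R]) `\` (E `&` [set w | (D w <= a)%R]).
    apply/seteqP; split => w /=; rewrite in_itv /=.
      by move=> [/andP[aD Db] Ew]; split => // -[_]; rewrite leNgt aD.
    move=> [[Ew Db]] /not_andP[//|/negP]; rewrite -ltNge => aD.
    by split => //; rewrite aD.
  rewrite measureD //; last by rewrite [ltLHS]muF ltry.
  rewrite [X in _ - mu X]setIidr; last first.
    by move=> w [Ew /= Da]; split; [exact: Ew|exact: le_trans Da ab].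
  rewrite [X in X - _]muF [X in _ - X]muF.
  by rewrite -EFinB -EFinM -mulrBr mulKf ?gt_eqF.
rewrite -rhoI -[LHS]mul1e -(divff (lt0r_neq0 c_gt0)) EFinM -muleA; congr (_ * _).
transitivity (\int[nu]_(t in `[0%R, +oo[) t%:E).
  rewrite ge0_integral_mscale //=.
  by move=> t; rewrite in_itv /= andbT lee_fin.
by apply: eq_measure_integral => A mA _; apply/esym/nuF.
Qed.
End measure_lemmas.

(** * The Markov property over events of the past *)

Section markov_renewal_past.
Context {d : measure_display} {Omega : measurableType d} {R : realType}.
Variables (m : nat) (X : nat -> Omega -> 'I_m) (T : nat -> {mfun Omega >-> R}).
Variables (Q : 'I_m -> 'I_m -> cumulative R R) (Pr : probability Omega R).
Hypothesis hMRP : is_markov_renewal_process X T Pr Q.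
Local Open Scope ereal_scope.
Local Notation past := (past X T).
Local Notation at_state n i := [set w | X n w = i].

Lemma past_setT n : past n setT.
Proof. exact: (@measurableT _ (g_sigma_algebraType _)). Qed.

Lemma past_setI n A B : past n A -> past n B -> past n (A `&` B).
Proof. exact: (@measurableI _ (g_sigma_algebraType _)). Qed.

Lemma past_setC n A : past n A -> past n (~` A).
Proof. exact: (@measurableC _ (g_sigma_algebraType _)). Qed.

Lemma past_le n p A : (n <= p)%N -> past n A -> past p A.
Proof.
move=> np; apply: sub_sigma_algebra2 => B [k kn AE].
by exists k => //; exact: leq_trans np.
Qed.

Lemma past_state n i : past n (at_state n i).
Proof. by apply: sub_sigma_algebra; exists n => //; left; exists i. Qed.

Lemma past_measurable n A : past n A -> measurable A.
Proof.
apply: smallest_sub; first exact: sigma_algebra_measurable.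
move=> B [k _ [[i ->]|[t ->]]]; first exact: mrp_measurable_state hMRP _ _.
rewrite (_ : [set _ | _] = T k @^-1` `]-oo, t]); first exact: measurable_funPTI.
by apply/seteqP; split => w /=; rewrite in_itv.
Qed.

Lemma measurable_state n i : measurable (at_state n i).
Proof. exact: mrp_measurable_state hMRP _ _. Qed.

Definition sojourn n : {mfun Omega >-> R} := (T n.+1 \- T n)%R.

Lemma sojourn_ge0 n w : (0 <= sojourn n w)%R.
Proof. by rewrite /sojourn /= subr_ge0; exact: mrp_epoch_nondecreasing hMRP _ _. Qed.

Lemma measurable_sojourn_le n t : measurable [set w | (sojourn n w <= t)%R].
Proof.
rewrite (_ : [set _ | _] = sojourn n @^-1` `]-oo, t]); first exact: measurable_funPTI.
by apply/seteqP; split => w /=; rewrite in_itv.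
Qed.

Lemma pr_sojourn_le n (i j : 'I_m) t A : past n A ->
  Pr (A `&` at_state n i `&` at_state n.+1 j `&` [set w | (sojourn n w <= t)%R])
  = Pr (A `&` at_state n i) * (Q i j t)%:E.
Proof. by move=> /(mrp_markov hMRP i j t) <-; rewrite -setIA. Qed.

Section jump.
Variable P : 'M[R]_m.
Hypothesis Q_cvg : forall i j, Q i j t @[t --> +oo%R] --> P i j.

(** The Markov property with t = N, as N tends to infinity: the events that bound the sojourn by N
    increase to the whole event. *)
Lemma pr_jump n (i j : 'I_m) A : past n A ->
  Pr (A `&` at_state n i `&` at_state n.+1 j) = Pr (A `&` at_state n i) * (P i j)%:E.
Proof.
move=> pA; have mA := past_measurable pA.
set E := A `&` _ `&` _.
have mE : measurable E by do 2?apply: measurableI => //; exact: measurable_state.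
pose S N := E `&` [set w | (sojourn n w <= N%:R)%R].
have mS N : measurable (S N) by apply: measurableI => //; exact: measurable_sojourn_le.
have bigS : \bigcup_N S N = E.
  rewrite -setI_bigcupr; apply/seteqP; split => [w []//|w Ew]; split => //.
  exists (Num.truncn (sojourn n w)).+1 => //=.
  by rewrite ltW // truncnS_gt.
have ndS : {homo S : a b / (a <= b)%N >-> (a <= b)%O}.
  move=> a b ab; apply/subsetPset => w [Ew /= Da]; split => //=.
  by apply: le_trans Da _; rewrite ler_nat.
have := @nondecreasing_cvg_mu _ _ _ Pr _ mS (bigcupT_measurable _ mS) ndS.
rewrite bigS => PrS.
apply: (cvg_unique (@ereal_hausdorff R) PrS).
have -> : Pr \o S = (fun N => Pr (A `&` at_state n i) * (Q i j N%:R)%:E).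
  by apply/funext => N; rewrite /= pr_sojourn_le.
apply: cvgeZl.
  by rewrite fin_num_measure //; apply: measurableI => //; exact: measurable_state.
apply: cvg_EFin; first exact: nearW.
exact: (cvg_comp _ _ (@cvgr_idn R) (@Q_cvg i j)).
Qed.

(** The Markov property says that, on this event, the sojourn has the law c dQ_ij with c the mass of
    the event before the jump. *)
Lemma integral_sojourn_jump n (i j : 'I_m) A : past n A ->
  \int[Pr]_(w in A `&` at_state n i `&` at_state n.+1 j) (sojourn n w)%:E
  = Pr (A `&` at_state n i) * kernel_mean Q i j.
Proof.
move=> pA; have mA := past_measurable pA.
have mE : measurable (A `&` at_state n i).
  by apply: measurableI => //; exact: measurable_state.
have PrE : (fine (Pr (A `&` at_state n i)))%:E = Pr (A `&` at_state n i).
  by rewrite fineK // fin_num_measure.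
rewrite -PrE; apply: integral_cumulative_law.
- by apply: measurableI => //; exact: measurable_state.
- exact: sojourn_ge0.
- exact: fine_ge0.
- rewrite PrE; apply: le_measure; rewrite ?inE //.
  by apply: measurableI => //; exact: measurable_state.
- by move=> t; rewrite [LHS]pr_sojourn_le // EFinM PrE.
Qed.

Hypothesis kernel_mean_fin : forall i j, kernel_mean Q i j < +oo.

Lemma kernel_mean_ge0 i j : 0 <= kernel_mean Q i j.
Proof.
by apply: integral_ge0 => t /=; rewrite in_itv /= andbT lee_fin.
Qed.

Lemma trivIset_setI_state n E (D : set 'I_m) : trivIset D (fun i => E `&` at_state n i).
Proof. by move=> i j _ _ [w [[_ <-] [_ <-]]]. Qed.

Lemma bigsetU_state n E : \big[setU/set0]_i (E `&` at_state n i) = E.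
Proof.
rewrite -bigcup_seq; apply/seteqP; split => [w [j _ []]//|w Ew].
by exists (X n w) => //=; exact: mem_index_enum.
Qed.

Lemma pr_sum_state n E : measurable E -> Pr E = \sum_i Pr (E `&` at_state n i).
Proof.
move=> mE; rewrite -[in LHS](bigsetU_state n E) measure_bigsetU_ord //.
  by move=> i; apply: measurableI => //; exact: measurable_state.
exact: trivIset_setI_state.
Qed.

Lemma integral_sum_state n E p : measurable E ->
  \int[Pr]_(w in E) (sojourn p w)%:E =
  \sum_i \int[Pr]_(w in E `&` at_state n i) (sojourn p w)%:E.
Proof.
move=> mE; rewrite -[in LHS](bigsetU_state n E) ge0_integral_bigsetU //.
- by move=> i; apply: measurableI => //; exact: measurable_state.
- exact: index_enum_uniq.
- exact: trivIset_setI_state.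
- by apply/measurable_EFinP; exact: measurable_funTS.
- by move=> w _; rewrite lee_fin sojourn_ge0.
Qed.

Lemma integral_sojourn n (i : 'I_m) A : past n A ->
  \int[Pr]_(w in A `&` at_state n i) (sojourn n w)%:E
  = Pr (A `&` at_state n i) * (mean_sojourn Q i 0)%:E.
Proof.
move=> pA; have mA := past_measurable pA.
rewrite (@integral_sum_state n.+1); last first.
  by apply: measurableI => //; exact: measurable_state.
under eq_bigr do rewrite integral_sojourn_jump //.
rewrite -ge0_sume_distrr; last by move=> j _; exact: kernel_mean_ge0.
congr (_ * _); rewrite mxE -sumEFin; apply: eq_bigr => j _.
by rewrite fineK // ge0_fin_numE // kernel_mean_ge0.
Qed.

(** * First passage from i to j as a series of sojourns *)

Section first_passage.
Variables i j : 'I_m.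

(** Step 0 is exempt from the constraint, so that i = j yields the return time. The [n]-th sojourn
    counts towards T_ij exactly on this event. *)
Definition avoid n : set Omega :=
  [set w | X 0%N w = i /\ forall r, (0 < r <= n)%N -> X r w != j].

Lemma avoidS n : avoid n.+1 = avoid n `&` ~` at_state n.+1 j.
Proof.
apply/seteqP; split => w /=.
  move=> [Xi Xj]; split; last by apply/eqP/Xj; rewrite ltnS leqnn.
  by split => // r /andP[r0 rn]; apply: Xj; rewrite r0 leqW.
move=> [[Xi Xj] /eqP Xn]; split => // r /andP[r0].
by rewrite leq_eqVlt => /predU1P[->//|rn]; apply: Xj; rewrite r0.
Qed.

Lemma past_avoid n : past n (avoid n).
Proof.
elim: n => [|n IHn].
  rewrite (_ : avoid 0 = at_state 0%N i); first exact: past_state.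
  by apply/seteqP; split => [w []//|w Xi]; split => // -[|r].
rewrite avoidS; apply: past_setI; first exact: past_le IHn.
by apply: past_setC; exact: past_state.
Qed.

Lemma measurable_avoid n : measurable (avoid n).
Proof. exact: (past_measurable (@past_avoid n)). Qed.

Local Notation q := (fine (Pr (at_state 0%N i))).

(** Induction on the last jump. The initial mass [q] remains as a factor because nothing is
    conditioned on the start. *)
Lemma pr_avoid_state n l :
  Pr (avoid n `&` at_state n l) = (q * (taboo_mx P j ^+ n) i l)%:E.
Proof.
elim: n l => [|n IHn] l.
  rewrite expr0 mxE; have [<-|il] := eqVneq i l.
    rewrite mulr1 fineK; last by rewrite fin_num_measure //; exact: measurable_state.
    congr (Pr _).
    by apply/seteqP; split => [w []//|w Xi]; split => //; split => // -[|r].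
  rewrite mulr0 (_ : _ `&` _ = set0) ?measure0 // -subset0 => w [[+ _]] /=.
  by move=> -> /eqP; rewrite (negPf il).
(* For l = j both sides vanish: column [j] of the taboo matrix is zero, and [avoid n.+1] excludes
   [j] at its last step. *)
rewrite exprSr mxE; have [->|lj] := eqVneq l j.
  rewrite big1 ?mulr0 => [|k _]; last by rewrite mxE eqxx mulr0.
  by rewrite avoidS -setIA setICl setI0 measure0.
have -> : avoid n.+1 `&` at_state n.+1 l = avoid n `&` at_state n.+1 l.
  rewrite avoidS; apply/seteqP; split => [w [[]]//|w [Aw /= Xl]]; split => //.
  by split => //=; rewrite Xl; exact/eqP.
rewrite (@pr_sum_state n); last first.
  by apply: measurableI; [exact: measurable_avoid|exact: measurable_state].
rewrite mulr_sumr -sumEFin; apply: eq_bigr => k _.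
rewrite setIAC pr_jump; last exact: past_avoid.
by rewrite IHn -EFinM -mulrA mxE lj mulr1n.
Qed.

Lemma pr_avoid n :
  Pr (avoid n) = (q * (taboo_mx P j ^+ n *m const_mx 1 : 'cV_m) i 0)%:E.
Proof.
rewrite (@pr_sum_state n); last exact: measurable_avoid.
rewrite mxE mulr_sumr -sumEFin; apply: eq_bigr => l _.
by rewrite pr_avoid_state mxE mulr1.
Qed.

Lemma integral_avoid_sojourn n : \int[Pr]_(w in avoid n) (sojourn n w)%:E =
  (q * (taboo_mx P j ^+ n *m mean_sojourn Q) i 0)%:E.
Proof.
rewrite (@integral_sum_state n); last exact: measurable_avoid.
rewrite mxE mulr_sumr -sumEFin; apply: eq_bigr => l _.
rewrite integral_sojourn; last exact: past_avoid.
by rewrite pr_avoid_state -EFinM mulrA.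
Qed.

Definition never : set Omega := \bigcap_n avoid n.

Lemma measurable_never : measurable never.
Proof. by apply: bigcapT_measurable => n; exact: measurable_avoid. Qed.

(* The second summand makes the series of these terms equal to the first passage
   time also on the null set of paths that never visit [j]. *)
Definition passage_term n w : \bar R :=
  ((fun w => (sojourn n w)%:E) \_ (avoid n)) w + (cst +oo \_ never) w.

(** If N is the first visit, [avoid n] holds exactly for n < N and the sojourns telescope to T_N -
    T_0 = T_N. If there is none, every term is +oo. *)
Lemma passage_term_sum w : X 0%N w = i ->
  \sum_(0 <= n <oo) passage_term n w = first_passage_time X T j w.
Proof.
move=> Xi; rewrite /first_passage_time; case: pselect => [visit|novisit].
  case: ex_minnP => N /andP[N_gt0 /eqP XN] Nmin.
  have avoidE n : avoid n w <-> (n < N)%N.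
    split => [[_ An]|nN].
      rewrite ltnNge; apply/negP => Nn; have := An N.
      by rewrite N_gt0 Nn XN eqxx => /(_ isT).
    split => // r /andP[r0 rn]; apply/negP => Xr.
    by have := Nmin r; rewrite r0 Xr => /(_ isT); rewrite leqNgt (leq_ltn_trans rn).
  have Nnever : ~ never w by move=> /(_ N I) /avoidE; rewrite ltnn.
  have termE n : passage_term n w = if (n < N)%N then (sojourn n w)%:E else 0.
    rewrite /passage_term !patchE (memNset Nnever) adde0.
    have [nN|Nn] := ltnP; first by rewrite mem_set //; exact/avoidE.
    by rewrite memNset // => /avoidE; rewrite ltnNge Nn.
  rewrite (nneseries_split 0 N); last first.
    by move=> n _; rewrite termE; case: ifP => // _; rewrite lee_fin sojourn_ge0.
  rewrite add0n [X in _ + X]eseries0 => [|n Nn _]; last by rewrite termE ltnNge Nn.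
  rewrite adde0 (eq_big_nat _ _ (F2 := fun n => (T n.+1 w - T n w)%:E)); last first.
    by move=> n /andP[_ nN]; rewrite termE nN.
  rewrite sumEFin telescope_sumr //; congr (_%:E).
  by rewrite (mrp_epoch0 hMRP) subr0.
have avoidw n : avoid n w.
  split => // r /andP[r0 _]; apply/negP => Xr; apply: novisit.
  by exists r; rewrite r0 Xr.
have termE n : passage_term n w = +oo.
  have neverw : never w by move=> k _; exact: avoidw.
  by rewrite /passage_term !patchE (mem_set neverw) (mem_set (avoidw n)) addey.
by apply: (@eseries_pinfty _ _ _ 0%N) => // n _; rewrite termE.
Qed.

(** Nonnegative terms allow integrating the series term by term. The [never] part contributes 0, and
    the others form the Neumann series of I - P_j applied to the mean sojourns. *)
Lemma integral_first_passage :
  (forall k l, (0 <= P k l)%R) -> P *m const_mx 1%R = const_mx 1%R :> 'cV_m ->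
  irreducible_mx P ->
  \int[Pr]_(w in at_state 0%N i) first_passage_time X T j w =
  (q * (invmx (1%:M - taboo_mx P j) *m mean_sojourn Q) i 0)%:E.
Proof.
move=> P_ge0 Pe Pirr; have m0 := measurable_state 0 i.
have avoid0 n : at_state 0%N i `&` avoid n = avoid n.
  by apply: setIidr => w [].
have never0 : at_state 0%N i `&` never = never.
  by apply: setIidr => w /(_ 0%N I) [].
have msojourn n : measurable_fun setT ((fun w => (sojourn n w)%:E) \_ (avoid n)).
  apply/(measurable_restrictT _ (measurable_avoid n)).
  by apply/measurable_EFinP; exact: measurable_funTS.
have mnever : measurable_fun setT ((cst +oo : Omega -> \bar R) \_ never).
  by apply/(measurable_restrictT _ measurable_never).
have sojourn_restrict_ge0 n w : 0 <= ((fun w => (sojourn n w)%:E) \_ (avoid n)) w.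
  by rewrite patchE; case: ifP => // _; rewrite lee_fin sojourn_ge0.
have never_restrict_ge0 w : 0 <= ((cst +oo : Omega -> \bar R) \_ never) w.
  by rewrite patchE; case: ifP => // _; rewrite leey.
(* [never] is contained in each [avoid n], whose probability q (P_j^n e)_i tends to 0. *)
have Prnever : Pr never = 0.
  have Pr_fin : Pr never \is a fin_num.
    by rewrite fin_num_measure //; exact: measurable_never.
  pose s n := (q * (taboo_mx P j ^+ n *m const_mx 1 : 'cV_m) i 0)%R.
  have s0 : s n @[n --> \oo] --> 0%R.
    rewrite -(mulr0 q); apply: cvgM; first exact: cvg_cst.
    exact: cvg_taboo_exp.
  rewrite -(fineK Pr_fin); congr (_%:E); apply/eqP; rewrite eq_le fine_ge0 // andbT.
  rewrite -(cvg_lim _ s0) //; apply: limr_ge; first by apply/cvg_ex; exists 0%R.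
  apply: nearW => n; rewrite -lee_fin fineK // /s -pr_avoid.
  apply: le_measure; rewrite ?inE; [exact: measurable_never|exact: measurable_avoid|].
  by move=> w /(_ n I).
rewrite (eq_integral (fun w => \sum_(0 <= n <oo) passage_term n w)); last first.
  by move=> w; rewrite inE => /= /passage_term_sum ->.
rewrite integral_nneseries //; last 2 first.
- by move=> n; apply: measurable_funTS; exact: emeasurable_funD.
- by move=> n w _; exact: adde_ge0.
have mean_ge0 k : (0 <= mean_sojourn Q k 0)%R.
  by rewrite mxE; apply: sumr_ge0 => l _; rewrite fine_ge0 // kernel_mean_ge0.
have termE n : \int[Pr]_(w in at_state 0%N i) passage_term n w =
    (q * (taboo_mx P j ^+ n *m mean_sojourn Q) i 0)%:E.
  rewrite ge0_integralD //; try exact: measurable_funTS.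
  rewrite -!integral_mkcondr avoid0 never0 integral_avoid_sojourn.
  by rewrite null_set_integral ?adde0 //; exact: measurable_never.
under eq_eseriesr do rewrite termE.
apply/cvg_lim => //; under eq_fun do rewrite sumEFin -mulr_sumr.
apply: cvg_EFin; first exact: nearW.
apply: cvgM; first exact: cvg_cst.
exact: cvg_sum_taboo_exp.
Qed.

End first_passage.
End jump.
End markov_renewal_past.

(** * The laws started from each state, and their mean first passage times *)

Section started_processes.
Context {d : measure_display} {Omega : measurableType d} {R : realType}.
Variables (m : nat) (X : nat -> Omega -> 'I_m) (T : nat -> {mfun Omega >-> R}).
Variables (Q : 'I_m -> 'I_m -> cumulative R R) (Pr : 'I_m -> probability Omega R).
Hypothesis hMRP : forall i, is_markov_renewal_process X T (Pr i) Q.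
Hypothesis hstart : forall i, (0 < Pr i [set w | X 0%N w = i])%E.
Local Notation P := (jump_matrix Q).
Local Notation q i := (fine (Pr i [set w | X 0%N w = i])).

Lemma pr_start_fin i : Pr i [set w | X 0%N w = i] \is a fin_num.
Proof. by rewrite fin_num_measure //; exact: measurable_state (hMRP i) _ _. Qed.

Lemma pr_start_gt0 i : 0 < q i.
Proof. by rewrite fine_gt0 // hstart -ge0_fin_numE // pr_start_fin. Qed.

(** The [lim] in [jump_matrix] is meaningful only once convergence is known. Q_ij is monotone, and
    bounded by 1: at step 0 the Markov property makes q_i Q_ij(t) the probability of a part of {X_0
    = i}, and q_i > 0. *)
Lemma cvg_kernel i j : Q i j t @[t --> +oo] --> P i j.
Proof.
rewrite mxE; apply: cvgP; apply: nondecreasing_cvgr.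
  exact: cumulative_is_nondecreasing.
exists 1 => _ [t _ <-].
have := pr_sojourn_le (hMRP i) i j t (@past_setT _ _ _ _ X T 0).
rewrite setTI -(fineK (pr_start_fin i)) -EFinM => QE.
rewrite -(ler_pM2l (pr_start_gt0 i)) mulr1 -lee_fin -QE fineK ?pr_start_fin //.
have mS := measurable_state (hMRP i).
apply: le_measure; rewrite ?inE.
- by do 2?apply: measurableI => //; exact: measurable_sojourn_le.
- exact: mS.
- by move=> w [[]].
Qed.

Lemma pr_first_jump i j :
  (Pr i ([set w | X 0%N w = i] `&` [set w | X 1%N w = j]) = (q i * P i j)%:E)%E.
Proof.
have := pr_jump (hMRP i) cvg_kernel i j (@past_setT _ _ _ _ X T 0).
by rewrite setTI EFinM (fineK (pr_start_fin i)).
Qed.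

Lemma jump_matrix_ge0 i j : 0 <= P i j.
Proof. by rewrite -(pmulr_rge0 _ (pr_start_gt0 i)) -lee_fin -pr_first_jump. Qed.

(** The event {X_0 = i} is partitioned by the value of X_1, and its positive mass is cancelled. *)
Lemma jump_matrix_stochastic : P *m const_mx 1 = const_mx 1 :> 'cV_m.
Proof.
apply/matrixP => i l; rewrite mxE [RHS]mxE.
apply: (mulfI (lt0r_neq0 (pr_start_gt0 i))); apply: EFin_inj.
rewrite mulr1 mulr_sumr -sumEFin fineK ?pr_start_fin //.
rewrite [RHS](@pr_sum_state _ _ _ _ _ _ _ _ (hMRP i) 1); last first.
  exact: measurable_state (hMRP i) _ _.
by apply: eq_bigr => j _; rewrite [const_mx _ _ _]mxE mulr1 pr_first_jump.
Qed.

Lemma mean_first_passageE :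
  (forall i j, (kernel_mean Q i j < +oo)%E) -> irreducible_mx P ->
  forall i j, mean_first_passage X T Pr i j =
    (invmx (1%:M - taboo_mx P j) *m mean_sojourn Q) i 0.
Proof.
move=> hfin Pirr i j; rewrite [LHS]mxE /cond_expectation_event.
rewrite (integral_first_passage (hMRP i) cvg_kernel hfin i j jump_matrix_ge0
  jump_matrix_stochastic Pirr).
by rewrite -EFinM /= mulrAC divff ?mul1r // gt_eqF // pr_start_gt0.
Qed.

(** The resolvent formula turned back into a fixed-point equation, the form in which the linear
    system takes the mean first passage times. *)
Lemma mean_first_passage_taboo :
  (forall i j, (kernel_mean Q i j < +oo)%E) -> irreducible_mx P ->
  let M := mean_first_passage X T Pr in
  forall j, col j M = mean_sojourn Q + taboo_mx P j *m col j M.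
Proof.
move=> hfin Pirr M j; apply/eqP; rewrite -subr_eq -[X in X - _]mul1mx -mulmxBl.
have -> : col j M = invmx (1%:M - taboo_mx P j) *m mean_sojourn Q.
  by apply/matrixP => i l; rewrite mxE ord1 mean_first_passageE.
rewrite mulKVmx //.
exact: unitmx_sub1_taboo jump_matrix_ge0 jump_matrix_stochastic Pirr _.
Qed.

End started_processes.

Theorem theorem3 (R : realType) (d : measure_display) (Omega : measurableType d)
  (m : nat) (Q : 'I_m -> 'I_m -> cumulative R R)
  (X : nat -> Omega -> 'I_m) (T : nat -> {mfun Omega >-> R})
  (Pr : 'I_m -> probability Omega R)
  (hMRP : forall i, is_markov_renewal_process X T (Pr i) Q)
  (hstart : forall i, (0 < Pr i [set w | X 0%N w = i])%E)
  (P : 'M[R]_m) (hP : P = jump_matrix Q)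
  (hirr : irreducible_mx P)
  (hfin : forall i j, (kernel_mean Q i j < +oo)%E)
  (mu : 'cV[R]_m) (hmu : mu = mean_sojourn Q)
  (pi : 'cV[R]_m) (e : 'cV[R]_m) (he : e = const_mx 1)
  (hpiP : pi^T *m P = pi^T) (hpi1 : pi^T *m e = 1%:M)
  (lambda : R) (hlambda : lambda = (pi^T *m mu) 0 0) (hlambda_gt0 : 0 < lambda)
  (k : 'cV[R]_m) (hk : k = k3 (mean_first_passage X T Pr)) :
  [/\ (forall G : 'M[R]_m, is_ginverse (1%:M - P) G ->
         k = lambda^-1 *: (G *m mu - \tr (G *m mu *m pi^T) *: e)
             + e - G *m e + \tr G *: e),
      (forall Z : 'M[R]_m, Z = invmx (1%:M - P + e *m pi^T) ->
         k = lambda^-1 *: (Z *m mu - \tr (Z *m mu *m pi^T) *: e)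
             + \tr Z *: e),
      (forall A : 'M[R]_m, is_group_inverse (1%:M - P) A ->
         k = lambda^-1 *: (A *m mu - \tr (A *m mu *m pi^T) *: e)
             + e + \tr A *: e)
    & (forall (u : 'cV[R]_m) (G : 'M[R]_m), (u^T *m e) 0 0 != 0 ->
         G = invmx (1%:M - P + mu *m u^T) ->
         k = (1%:M - G + (\tr G)%:M) *m e)].

Proof.
subst P mu e lambda k.
have P_ge0 := jump_matrix_ge0 hMRP hstart.
have Pe := jump_matrix_stochastic hMRP hstart.
have ker1P (v : 'cV[R]_m) i :
    (1%:M - jump_matrix Q) *m v = 0 -> v = v i 0 *: const_mx 1.
  exact: (ker_sub1P P_ge0 Pe hirr).
have M_taboo := mean_first_passage_taboo hMRP hstart hfin hirr.
split.
- exact: (k3_ginverse Pe ker1P hpiP hpi1 hlambda_gt0 M_taboo).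
- exact: (k3_fundamental Pe ker1P hpiP hpi1 hlambda_gt0 M_taboo).
- exact: (k3_group_inverse Pe ker1P hpiP hpi1 hlambda_gt0 M_taboo).
- exact: (k3_rank_one Pe ker1P hpiP hpi1 hlambda_gt0 M_taboo).
Qed.
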